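(* Let $0\le n\le N-1$ and $1\le k\le N-n$, let $\mathcal{A}\subseteq\{0,1,\ldots,N\}$, and let $s\in\mathbb{C}$ with $\mathrm{Re}(s)\ge 0$ (such that the inverses displayed below exist). Then $$\widetilde{\mathbf C}_{\mathcal{A}}^{n,n+k}(s)=\widetilde{\mathbf C}_{\mathcal{A}}^{n,n+1}(s)\,\widetilde{\mathbf C}_{\mathcal{A}}^{n+1,n+2}(s)\cdots\widetilde{\mathbf C}_{\mathcal{A}}^{n+k-1,n+k}(s),$$ where $$\widetilde{\mathbf C}_{\mathcal{A}}^{0,1}(s)=-\left(\mathbf Q^{[0,0]}-s\,\mathbf C_0\, I(0\in\mathcal{A})\right)^{-1}\mathbf Q^{[0,1]},$$ and for $m=1,\ldots,n+k-1$, $$\widetilde{\mathbf C}_{\mathcal{A}}^{m,m+1}(s)=-\left(\mathbf Q^{[m,m]}-s\,\mathbf C_m\, I(m\in\mathcal{A})+\mathbf Q^{[m,m-1]}\,\widetilde{\mathbf C}_{\mathcal{A}}^{m-1,m}(s)\right)^{-1}\mathbf Q^{[m,m+1]}.$$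
   Context: Level-dependent quasi-birth-and-death process (LD-QBD): a continuous-time Markov chain $\{(X(t),\varphi(t)):t\ge 0\}$ on the finite state space $\mathcal{S}=\{(n,i): n=0,1,\ldots,N;\ i=0,1,\ldots,K_n\}$, with level $X(t)$ and phase $\varphi(t)$, such that each transition changes the level by at most one. Its generator $\mathbf Q$ has off-diagonal entries the transition rates $q_{(n,i)\to(n',j)}$ and diagonal entries $q_{(n,i)\to(n,i)}=-\sum_{(n',j)\ne(n,i)}q_{(n,i)\to(n',j)}$. It is block tridiagonal with blocks $\mathbf Q^{[n,n']}=[q_{(n,i)\to(n',j)}]_{i=0,\ldots,K_n;\,j=0,\ldots,K_{n'}}$, which are zero if $|n-n'|>1$ and may depend on $n$. Costs accrue at rate $c(n,i)\ge 0$ per unit time in state $(n,i)$; $\mathbf C_n=\mathrm{diag}(c(n,i))_{i}$. $I(\cdot)$ is the indicator ($1$ if the condition is true, $0$ otherwise). For a set of levels $\mathcal{A}\subseteq\{0,\ldots,N\}$, $$C_{\mathcal{A}}(t)=\int_0^t c(X(u),\varphi(u))\,I(X(u)\in\mathcal{A})\,du$$ is the total cost accumulated in $\mathcal A$ up to time $t$. The first hitting time of level $m$ is $\theta_m=\inf\{t>0: X(t)=m\}$. For $1\le k\le N-n$, $\widetilde{\mathbf C}_{\mathcal{A}}^{n,n+k}(s)=[\widetilde C_{\mathcal{A};ij}^{n,n+k}(s)]_{i=0,\ldots,K_n;\,j=0,\ldots,K_{n+k}}$ is the matrix of Laplace–Stieltjes transforms $$\widetilde C_{\mathcal{A};ij}^{n,n+k}(s)=\int_{0}^{\infty}e^{-sz}\,c^{n,n+k}_{\mathcal{A};i,j}(z)\,dz,$$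 $$c^{n,n+k}_{\mathcal{A};i,j}(z)=\frac{\partial}{\partial z}\mathbb P\big(C_{\mathcal{A}}(\theta_{n+k})\le z,\ \varphi(\theta_{n+k})=j\mid X(0)=n,\varphi(0)=i\big),$$ where the density is understood in the generalized sense (the distribution may have an atom at $0$), i.e. $\widetilde C_{\mathcal{A};ij}^{n,n+k}(s)=\mathbb E\big[e^{-sC_{\mathcal{A}}(\theta_{n+k})}I(\theta_{n+k}<\infty,\varphi(\theta_{n+k})=j)\mid X(0)=n,\varphi(0)=i\big]$. *)

(* Defs.v *)
From HB Require Import structures.
From mathcomp Require Import all_boot all_order all_algebra.
From mathcomp Require Import complex.
From mathcomp Require Import all_classical all_reals all_analysis.
Set Implicit Arguments.
Unset Strict Implicit.
Unset Printing Implicit Defensive.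
Import Order.TTheory GRing.Theory Num.Theory.
Import numFieldNormedType.Exports.
Local Open Scope classical_set_scope.
Local Open Scope ring_scope.

(* Data attached to a level n (number of phases, blocks, costs, laws) are      *)
(* indexed by n : nat, so that consecutive levels are n and n.+1; the chain    *)
(* itself only lives on the levels 0, ..., N, and no hypothesis constrains the *)
(* data of a level above N.                                                    *)

Definition state (N : nat) (K : nat -> nat) : finType :=
  {n : 'I_N.+1 & 'I_(K n).+1}.

Definition level N K (x : state N K) : nat := tag x.

Definition phase N K (x : state N K) : nat := tagged x.

Section Generator.
Variables (R : realType) (N : nat) (K : nat -> nat).

Definition rate (Q : forall n m : nat, 'M[R]_((K n).+1, (K m).+1))
    (x y : state N K) : R :=
  Q (tag x) (tag y) (tagged x) (tagged y).

Record is_LDQBD_generator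
    (Q : forall n m : nat, 'M[R]_((K n).+1, (K m).+1)) : Prop := {
  rate_ge0 : forall x y, x != y -> 0 <= rate Q x y ;
  rate_diag : forall x, rate Q x x = - \sum_(y | y != x) rate Q x y ;
  rate_skip : forall x y,
    ((level x).+1 < level y)%N || ((level y).+1 < level x)%N ->
    rate Q x y = 0 }.

End Generator.

Section MarkovChain.
Variables (R : realType) (N : nat) (K : nat -> nat).
Variables (d : measure_display) (T : measurableType d).
Variables (P : forall n : nat, 'I_(K n).+1 -> probability T R).
Variable Z : R -> T -> state N K.

(* P n i is the conditional law given X(0) = n and phi(0) = i. *)
Definition law (x : state N K) : probability T R := P (tagged x).

Definition history (u : R) : set (set T) :=
  <<s [set E | exists r x, 0 <= r <= u /\ E = [set w | Z r w = x]] >>.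

Definition transition (t : R) (x y : state N K) : R :=
  fine (law x [set w | Z t w = y]).

(* Right-continuous time-homogeneous Markov chain, under the laws of its       *)
(* possible starting states, with generator Q = lim_(h -> 0+) (p_h - 1) / h.   *)
(* Right continuity is for the discrete topology on the state space; the       *)
(* Markov property is written without dividing by the probability of the       *)
(* conditioning event.                                                         *)
Record is_CTMC (Q : forall n m : nat, 'M[R]_((K n).+1, (K m).+1)) : Prop := {
  ctmc_measurable : forall t x, 0 <= t -> measurable [set w | Z t w = x] ;
  ctmc_right_continuous : forall w t, 0 <= t ->
    \forall u \near t^'+, Z u w = Z t w ;
  ctmc_start : forall x, law x [set w | Z 0 w = x] = 1%:E ;
  ctmc_markov : forall x u t y z (E : set T), 0 <= u -> 0 <= t ->
    history u E ->
    law x (E `&` [set w | Z u w = y] `&` [set w | Z (u + t) w = z]) =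
    (law x (E `&` [set w | Z u w = y]) * (transition t y z)%:E)%E ;
  ctmc_generator : forall x y,
    (transition h x y - (x == y)%:R) / h @[h --> 0^'+] --> rate Q x y }.

Definition hitting_time (m : nat) (w : T) : \bar R :=
  ereal_inf [set t%:E | t in [set t : R | 0 < t /\ level (Z t w) = m]].

Definition acc_cost (c : forall n : nat, 'I_(K n).+1 -> R) (A : pred nat)
    (t : R) (w : T) : R :=
  \int[lebesgue_measure]_(u in `[0, t])
    (c (level (Z u w)) (tagged (Z u w)) * (A (level (Z u w)))%:R).

Definition cexp (z : R[i]) : R[i] :=
  (expR (complex.Re z) * cos (complex.Im z)
   +i* (expR (complex.Re z) * sin (complex.Im z)))%C.

Definition cexpectation (mu : probability T R) (f : T -> R[i]) : R[i] :=
  ((\int[mu]_w complex.Re (f w)) +i* (\int[mu]_w complex.Im (f w)))%C.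

(* Where the hitting time is infinite, fine maps it to 0, but the indicator    *)
(* vanishes.                                                                   *)
Definition LST (c : forall n : nat, 'I_(K n).+1 -> R) (A : pred nat)
    (s : R[i]) (n m : nat) : 'M[R[i]]_((K n).+1, (K m).+1) :=
  \matrix_(i, j) cexpectation (P i) (fun w =>
    let theta := hitting_time m w in
    cexp (- s * (acc_cost c A (fine theta) w)%:C%C) *
    ((theta < +oo)%E && (phase (Z (fine theta) w) == j))%:R).

End MarkovChain.

Section Blocks.
Variables (R : realType) (K : nat -> nat).

Definition cblock (Q : forall n m : nat, 'M[R]_((K n).+1, (K m).+1))
    (n m : nat) : 'M[R[i]]_((K n).+1, (K m).+1) :=
  map_mx (fun r : R => r%:C%C) (Q n m).

Definition cost_mx (c : forall n : nat, 'I_(K n).+1 -> R) (n : nat) :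
    'M[R[i]]_((K n).+1) :=
  diag_mx (\row_i (c n i)%:C%C).

(* M n *m M n.+1 *m ... *m M (n + k - 1). The upper level is written k + n     *)
(* because k.+1 + n is convertible to (k + n).+1, which types the product.     *)
Fixpoint level_prod (M : forall m : nat, 'M[R[i]]_((K m).+1, (K m.+1).+1))
    (n k : nat) : 'M[R[i]]_((K n).+1, (K (k + n)%N).+1) :=
  match k with
  | 0 => 1%:M
  | k'.+1 => level_prod M n k' *m M (k' + n)%N
  end.

End Blocks.

(* Main.v *)
Require Import Defs.
From HB Require Import structures.
From mathcomp Require Import all_boot all_order all_algebra.
From mathcomp Require Import complex.
From mathcomp Require Import all_classical all_reals all_analysis.
From mathcomp Require Import measurable_realfun zify ring.
Set Implicit Arguments.
Unset Strict Implicit.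
Unset Printing Implicit Defensive.
Import Order.TTheory GRing.Theory Num.Theory.
Import numFieldNormedType.Exports.
Local Open Scope classical_set_scope.
Local Open Scope ring_scope.

(* The chain is sampled at the times h, 2h, 3h, ... Conditioning the sampled   *)
(* chain on its first step gives a linear system for the transform of the      *)
(* sampled cost up to the first sampled visit to level m.  By right continuity *)
(* of the paths, the sampled hitting times and Riemann sums converge to the    *)
(* true ones as h tends to 0; dividing the linear system by h therefore yields *)
(* in the limit sum_y q(x,y) L(y) = s c(x) L(x) for x off level m, with        *)
(* boundary values at level m.  No strong Markov property is needed: this      *)
(* system is block tridiagonal, and eliminating the levels from 0 upwards with *)
(* the invertible pivots gives the recursion and the product formula at once.  *)

(** * Dominated convergence and Riemann sums *)

(** Fix a target level t and let the starting level vary. The transforms towards t form a family of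
    matrices, [LST_bd], equal to the identity at t. Off t they solve a linear system whose matrix is
    the generator with s times the cost rate subtracted on the diagonal ([generator_equation], in
    block form [block_equation]). Eliminating the blocks from level 0 upwards gives, for every t >
    m, the transform from m as -U^-1 Q[m,m+1] times the transform from m+1, where the pivot U does
    not depend on t. The choice t = m+1 identifies the coefficient as the one-level transform, and
    iterating over m gives the product; this is [LST_elimination].

    The system itself comes from the sampled chain: [grid_step] is its exact first-step equation,
    [grid_value_cvg] the pathwise convergence as the step vanishes, and [taboo_rate_cvg] the limit
    of the coefficients. All random variables involved have modulus at most 1, so [cexpectation_cvg]
    carries pathwise limits over to expectations. *)

Section RealAnalysis.
Variable R : realType.

Lemma bounded_integrable d (T : measurableType d)
    (mu : {measure set T -> \bar R}) (D : set T) (f : T -> R) (C : R) :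
  measurable D -> (mu D < +oo)%E -> measurable_fun D f ->
  (forall x, D x -> `|f x| <= C) -> mu.-integrable D (EFin \o f).
Proof.
move=> mD muD mf fC; apply: measurable_bounded_integrable => //.
exists C; split; first exact: num_real.
by move=> M CM x Dx /=; exact: le_trans (fC x Dx) (ltW CM).
Qed.

(** On a set of finite measure the constant [C] is an integrable dominating function. *)
Lemma bounded_cvg_Rintegral d (T : measurableType d)
    (mu : {measure set T -> \bar R}) (D : set T) (f_ : nat -> T -> R)
    (f : T -> R) (C : R) :
  measurable D -> (mu D < +oo)%E -> (forall n, measurable_fun D (f_ n)) ->
  (forall n x, D x -> `|f_ n x| <= C) ->
  (forall x, D x -> f_ n x @[n --> \oo] --> f x) ->
  \int[mu]_(x in D) f_ n x @[n --> \oo] --> \int[mu]_(x in D) f x.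
Proof.
move=> mD muD mf_ f_C f_f.
have mf : measurable_fun D f by exact: measurable_fun_cvg mf_ f_f.
have fC x : D x -> `|f x| <= C.
  move=> Dx; have h : `|f_ n x| @[n --> \oo] --> `|f x|.
    by apply: cvg_norm; exact: f_f.
  rewrite -(cvg_lim (@Rhausdorff R) h); apply: limr_le.
    by apply/cvg_ex; exists (`|f x|).
  by apply: nearW => n; exact: f_C.
have If := bounded_integrable mD muD mf fC.
rewrite /Rintegral; apply: fine_cvg.
rewrite fineK ?integrable_fin_num//.
apply: (@dominated_cvg _ _ _ mu _ mD (fun n x => (f_ n x)%:E) (EFin \o f)
  (fun=> C%:E)).
- by move=> n; apply/measurable_EFinP.
- by move=> x Dx; apply: cvg_EFin; [exact: nearW|exact: f_f].
- by [].
- apply: (bounded_integrable (C := `|C|) mD muD) => //.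
- by move=> n x Dx; rewrite lee_fin; exact: f_C.
Qed.

(** The step sizes are always [harmonic n], that is 1/(n+1), so derivatives at 0 are needed only
    along this sequence. *)
Lemma is_derive_cvg_harmonic (f : R -> R) (df : R) :
  is_derive (0 : R) 1 f df ->
  (f (harmonic n) - f 0) / harmonic n @[n --> \oo] --> df.
Proof.
move=> [fD <-].
have /cvgr_dnbhsP/(_ (@harmonic R)) := fD.
have h0 n : @harmonic R n != 0 by rewrite /harmonic invr_neq0.
move=> /(_ (conj h0 cvg_harmonic)).
apply: cvg_trans; apply: near_eq_cvg; apply: nearW => n /=.
rewrite addr0 [LHS]mulrC; congr ((f _ - _) * _).
by rewrite /GRing.scale /= mulr1.
Qed.

End RealAnalysis.

(** * Complex sequences and the complex exponential *)

Section ComplexSequences.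
Variable R : realType.
Implicit Types (u v : nat -> R[i]) (z : R[i]).

(** Componentwise, like [cexpectation], so that every limit reduces to two real ones. *)
Definition ccvg u z : Prop :=
  complex.Re (u n) @[n --> \oo] --> complex.Re z /\
  complex.Im (u n) @[n --> \oo] --> complex.Im z.

Lemma ccvg_cst z : ccvg (fun=> z) z.
Proof. by split; exact: cvg_cst. Qed.

Lemma ccvgD u v z1 z2 :
  ccvg u z1 -> ccvg v z2 -> ccvg (fun n => u n + v n) (z1 + z2).
Proof.
move=> [u1 u2] [v1 v2]; split.
  rewrite raddfD; under eq_fun do rewrite raddfD; exact: cvgD.
rewrite raddfD; under eq_fun do rewrite raddfD; exact: cvgD.
Qed.

Lemma cReM z1 z2 : complex.Re (z1 * z2) =
  complex.Re z1 * complex.Re z2 - complex.Im z1 * complex.Im z2.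
Proof. by case: z1 z2 => [? ?] [? ?]. Qed.

Lemma cImM z1 z2 : complex.Im (z1 * z2) =
  complex.Re z1 * complex.Im z2 + complex.Im z1 * complex.Re z2.
Proof. by case: z1 z2 => [? ?] [? ?]. Qed.

Lemma ccvgM u v z1 z2 :
  ccvg u z1 -> ccvg v z2 -> ccvg (fun n => u n * v n) (z1 * z2).
Proof.
move=> [u1 u2] [v1 v2]; split.
  rewrite cReM; under eq_fun do rewrite cReM.
  by apply: cvgB; exact: cvgM.
rewrite cImM; under eq_fun do rewrite cImM.
by apply: cvgD; exact: cvgM.
Qed.

Lemma ccvg_sum (I : Type) (r : seq I) (u : I -> nat -> R[i]) (z : I -> R[i]) :
  (forall i, ccvg (u i) (z i)) ->
  ccvg (fun n => \sum_(i <- r) u i n) (\sum_(i <- r) z i).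
Proof.
move=> uz; elim: r => [|i r IH].
  by rewrite big_nil; under eq_fun do rewrite big_nil; exact: ccvg_cst.
by rewrite big_cons; under eq_fun do rewrite big_cons; exact: ccvgD.
Qed.

Lemma ccvg_unique u z1 z2 : ccvg u z1 -> ccvg u z2 -> z1 = z2.
Proof.
case: z1 z2 => [a1 b1] [a2 b2] [/= ua1 ub1] [/= ua2 ub2].
by congr (_ +i* _)%C; [exact: cvg_unique ua1 ua2|exact: cvg_unique ub1 ub2].
Qed.

Lemma ccvg_eq u v z : u =1 v -> ccvg u z -> ccvg v z.
Proof. by move=> /funext ->. Qed.

Lemma ccvg_near_eq u v z : (\forall n \near \oo, u n = v n) ->
  ccvg u z -> ccvg v z.
Proof.
move=> uv [u1 u2]; split.
  apply: cvg_trans u1; apply: near_eq_cvg.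
  by apply: filterS uv => n ->.
apply: cvg_trans u2; apply: near_eq_cvg.
by apply: filterS uv => n ->.
Qed.

Lemma ccvg_near_cst u z : (\forall n \near \oo, u n = z) -> ccvg u z.
Proof.
move=> uz; apply: (@ccvg_near_eq (fun=> z)); last exact: ccvg_cst.
by apply: filterS uz => n ->.
Qed.

Lemma ccvg_shift u z : ccvg u z -> ccvg (fun n => u n.+1) z.
Proof. move=> [u1 u2]; split.
  by rewrite (cvg_shiftS (fun n => complex.Re (u n))).
by rewrite (cvg_shiftS (fun n => complex.Im (u n))). Qed.

Lemma ccvg_real (u : nat -> R) (x : R) :
  u n @[n --> \oo] --> x -> ccvg (fun n => (u n)%:C%C) x%:C%C.
Proof. by move=> ux; split => //=; exact: cvg_cst. Qed.

(** Squared modulus: real-valued, multiplicative and free of square roots. *)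
Definition sqmod z : R := complex.Re z ^+ 2 + complex.Im z ^+ 2.

Lemma sqmodM z1 z2 : sqmod (z1 * z2) = sqmod z1 * sqmod z2.
Proof. rewrite /sqmod cReM cImM; ring. Qed.

Lemma sqmod_ge0 z : 0 <= sqmod z.
Proof. by rewrite addr_ge0// sqr_ge0. Qed.

Lemma Re_le1 z : sqmod z <= 1 -> `|complex.Re z| <= 1.
Proof.
rewrite /sqmod => z1.
rewrite -(@ler_sqr R) ?nnegrE// expr1n real_normK ?num_real//.
by apply: le_trans z1; rewrite lerDl sqr_ge0.
Qed.

Lemma Im_le1 z : sqmod z <= 1 -> `|complex.Im z| <= 1.
Proof.
rewrite /sqmod => z1.
rewrite -(@ler_sqr R) ?nnegrE// expr1n real_normK ?num_real//.
by apply: le_trans z1; rewrite lerDr sqr_ge0.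
Qed.

Lemma cexpD z1 z2 : cexp (z1 + z2) = cexp z1 * cexp z2.
Proof.
case: z1 z2 => [a1 b1] [a2 b2]; rewrite /cexp /= expRD cosD sinD.
by apply/eqP; rewrite eq_complex /= ; apply/andP; split; apply/eqP; ring.
Qed.

Lemma cexp0 : cexp (0 : R[i]) = 1.
Proof. by rewrite /cexp /= expR0 cos0 sin0 mulr1 mulr0. Qed.

Lemma sqmod_cexp z : sqmod (cexp z) = expR (complex.Re z) ^+ 2.
Proof.
rewrite /sqmod /cexp /= !exprMn -mulrDr cos2Dsin2 mulr1 //.
Qed.

Lemma sqmod_cexp_le1 z : complex.Re z <= 0 -> sqmod (cexp z) <= 1.
Proof.
move=> z0; rewrite sqmod_cexp expr_le1 ?expR_ge0//.
by rewrite -expR0 ler_expR.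
Qed.

Lemma ccvg_cexp u z : ccvg u z -> ccvg (fun n => cexp (u n)) (cexp z).
Proof.
move=> [u1 u2].
have h1 : expR (complex.Re (u n)) @[n --> \oo] --> expR (complex.Re z).
  by apply: continuous_cvg => //; exact: continuous_expR.
have h2 : cos (complex.Im (u n)) @[n --> \oo] --> cos (complex.Im z).
  by apply: continuous_cvg => //; exact: continuous_cos.
have h3 : sin (complex.Im (u n)) @[n --> \oo] --> sin (complex.Im z).
  by apply: continuous_cvg => //; exact: continuous_sin.
by split; rewrite /cexp /=; exact: cvgM.
Qed.

(** Product rule at 0 for [expR] times [cos] and for [expR] times [sin]. This is the source of the
    cost term in the limiting equation. *)
Lemma cexp_diff_quotient z :
  ccvg (fun n => (cexp ((harmonic n)%:C%C * z) - 1) * (harmonic n)^-1%:C%C) z.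
Proof.
case: z => a b.
have L (c : R) : is_derive (0 : R) 1 (fun t : R => t * c) c.
  have -> : (fun t : R => t * c) = (id * cst c)%R by [].
  by apply: is_derive_eq; rewrite /GRing.scale/= mulr0 add0r mulr1.
have dE : is_derive (0 : R) 1 (expR \o (fun t : R => t * a)) a.
  by apply: is_derive_eq; rewrite mul0r expR0 mul1r.
have dC : is_derive (0 : R) 1 (cos \o (fun t : R => t * b)) 0.
  by apply: is_derive_eq; rewrite mul0r sin0 oppr0 mul0r.
have dS : is_derive (0 : R) 1 (sin \o (fun t : R => t * b)) b.
  by apply: is_derive_eq; rewrite mul0r cos0 mul1r.
split; rewrite /cexp.
- have h : is_derive (0 : R) 1 (fun t : R => expR (t * a) * cos (t * b)) _ :=
    is_deriveM dE dC.
  rewrite /= !mul0r expR0 cos0 /GRing.scale /= mulr0 add0r mul1r in h.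
  apply: cvg_trans (is_derive_cvg_harmonic h).
  apply: near_eq_cvg; apply: nearW => n /=.
  by rewrite !mul0r expR0 cos0 mulr1 !subr0 !addr0 mulr0 subr0.
- have h : is_derive (0 : R) 1 (fun t : R => expR (t * a) * sin (t * b)) _ :=
    is_deriveM dE dS.
  rewrite /= !mul0r expR0 sin0 /GRing.scale /= mul0r addr0 mul1r in h.
  apply: cvg_trans (is_derive_cvg_harmonic h).
  apply: near_eq_cvg; apply: nearW => n /=.
  by rewrite !mul0r expR0 sin0 mulr0 mulr0 !subr0 !addr0 add0r.
Qed.

End ComplexSequences.

(** * Right Riemann sums of right-continuous functions *)

Section Riemann.
Variable R : realType.

Lemma near_right_ex (S : Type) (z : R -> S) (u : R) :
  (\forall v \near u^'+, z v = z u) ->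
  exists2 e : R, 0 < e & forall v, u <= v < u + e -> z v = z u.
Proof.
move=> [e /= e0 he]; exists e => // v /andP[uv ve].
move: uv; rewrite le_eqVlt => /predU1P[->//|uv].
by apply: he => //=; rewrite ltr0_norm ?subr_lt0// opprB ltrBlDl.
Qed.

Lemma Rintegral_sum d (T : measurableType d) (mu : {measure set T -> \bar R})
    (D : set T) (I : Type) (r : seq I) (f : I -> T -> R) :
  measurable D -> (forall i, mu.-integrable D (EFin \o f i)) ->
  \int[mu]_(x in D) (\sum_(i <- r) f i x) =
  \sum_(i <- r) \int[mu]_(x in D) f i x.
Proof.
move=> mD fi; elim: r => [|i r IH].
  rewrite big_nil; under eq_Rintegral do rewrite big_nil.
  by rewrite Rintegral_cst// mul0r.
rewrite big_cons -IH; under eq_Rintegral do rewrite big_cons.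
rewrite RintegralD//.
have -> : EFin \o (fun x => \sum_(j <- r) f j x) =
          fun x => (\sum_(j <- r) (EFin \o f j) x)%E.
  by apply/funext => x /=; rewrite sumEFin.
exact: integrable_sum.
Qed.

Lemma RintegralZ_indic d (T : measurableType d)
    (mu : {measure set T -> \bar R}) (D E : set T) (a : R) :
  measurable D -> (mu D < +oo)%E -> measurable E ->
  \int[mu]_(x in D) (a * \1_E x) = a * fine (mu (E `&` D)).
Proof.
move=> mD muD mE; rewrite RintegralZl//; last first.
  apply: (bounded_integrable (C := 1)) => //.
  by move=> x _; rewrite ger0_norm ?indicE// lern1 leq_b1.
by rewrite /Rintegral integral_indic.
Qed.

(** Cell i contains [u] exactly when i is the integer part of u / h, so at most one summand
    survives. *)
Lemma sum_indic_grid (h u : R) (F : nat -> R) (k : nat) : 0 < h -> 0 <= u ->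
  \sum_(i < k) F i * \1_`[i%:R * h, i.+1%:R * h[%classic u =
  if (Num.truncn (u / h) < k)%N then F (Num.truncn (u / h)) else 0.
Proof.
move=> h0 u0; set t := Num.truncn _.
have iE (i : nat) : (\1_`[i%:R * h, i.+1%:R * h[%classic u : R) = (t == i)%:R.
  rewrite indicE mem_setE in_itv /= /t truncn_eq.
    by rewrite ler_pdivlMr// ltr_pdivrMr.
  exact: divr_ge0 u0 (ltW h0).
case: ifPn => tk.
  rewrite (bigD1 (Ordinal tk))//= iE eqxx mulr1 big1 ?addr0// => i it.
  rewrite iE (_ : (t == i) = false) ?mulr0//.
  by apply: contraNF it => /eqP ti; apply/eqP/val_inj.
rewrite big1// => i _; rewrite iE (_ : (t == i) = false) ?mulr0//.
by apply: contraNF tk => /eqP ->.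
Qed.

(* The step function equal to phi (i.+1 * h) on [i * h, i.+1 * h) converges  *)
(* pointwise to phi on [0, th): only right limits of phi are used.           *)
Lemma cvg_Riemann_right (phi : R -> R) (G th : R) (k : nat -> nat) :
  (forall u, `|phi u| <= G) ->
  (forall u : R, 0 <= u -> \forall v \near u^'+, phi v = phi u) ->
  0 <= th ->
  (\forall p \near \oo,
    (k p)%:R * harmonic p <= th <= (k p).+1%:R * harmonic p) ->
  \sum_(i < k p) phi (i.+1%:R * harmonic p) * harmonic p @[p --> \oo] -->
  \int[lebesgue_measure]_(u in `[0, th]) phi u.
Proof.
move=> phiG phir th0 kth.
(* The endpoint [th] lies in no cell, so it is left out; it has measure zero. *)
set D : set R := `[0, th[%classic.
pose f (p : nat) (u : R) : R := \sum_(i < k p) phi (i.+1%:R * harmonic p) *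
   \1_`[i%:R * harmonic p, i.+1%:R * harmonic p[%classic u.
have hp0 p : (0 : R) < harmonic p by rewrite /harmonic invr_gt0 ltr0n.
have mD : measurable D by exact: measurable_itv.
have muD : (lebesgue_measure D < +oo)%E.
  rewrite /D lebesgue_measure_itv /=.
  by case: ifP => _; rewrite ?ltry// -EFinB ltry.
have D0 u : D u -> 0 <= u by rewrite /D /= in_itv /= => /andP[].
have fE p u : D u -> f p u = if (Num.truncn (u / harmonic p) < k p)%N
    then phi ((Num.truncn (u / harmonic p)).+1%:R * harmonic p) else 0.
  move=> Du; rewrite /f.
  by rewrite (sum_indic_grid (fun i => phi (i.+1%:R * harmonic p)))// D0.
have G0 : 0 <= G by exact: le_trans (normr_ge0 _) (phiG 0).
have fG p u : D u -> `|f p u| <= G.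
  by move=> Du; rewrite fE//; case: ifP => _; rewrite ?normr0.
have mf p : measurable_fun D (f p).
  apply: measurable_sum => i; exact: measurable_funM.
have ff u : D u -> f p u @[p --> \oo] --> phi u.
  move=> Du; have u0 := D0 _ Du.
  have [e e0 he] := near_right_ex (phir _ u0).
  have uth : u < th by move: Du; rewrite /D /= in_itv /= => /andP[].
  have thu : 0 < th - u by rewrite subr_gt0.
  apply: cvg_near_cst; near=> p.
  have he1 : harmonic p < e.
    by near: p; exact: (near_infty_natSinv_lt (PosNum e0)).
  have he2 : harmonic p < th - u.
    by near: p; exact: (near_infty_natSinv_lt (PosNum thu)).
  have /andP[_ kp2] : (k p)%:R * harmonic p <= th <= (k p).+1%:R * harmonic p.
    by near: p.
  rewrite fE//; set t := Num.truncn _.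
  have /andP[t1 t2] : t%:R <= u / harmonic p < t.+1%:R.
    by apply: truncn_itv; rewrite divr_ge0// ltW.
  rewrite ler_pdivlMr// in t1; rewrite ltr_pdivrMr// in t2.
  have t3 : t.+1%:R * harmonic p <= u + harmonic p.
    by rewrite -natr1 mulrDl mul1r lerD2r.
  (* The cell of [u] ends by u + harmonic p, which is less than th and hence less than (k p + 1)
     harmonic p; so t + 1 < k p + 1. *)
  have -> : (t < k p)%N.
    rewrite -ltnS -(ltr_nat R) -(ltr_pM2r (hp0 p)).
    by apply: le_lt_trans t3 _; apply: lt_le_trans kp2; rewrite -ltrBrDl.
  apply: he; rewrite (ltW t2)/=; apply: le_lt_trans t3 _.
  by rewrite ltrD2l.
(* Measurability of [phi] comes from its being a pointwise limit of step functions. *)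
have Iphi : lebesgue_measure.-integrable D (EFin \o phi).
  apply: (bounded_integrable (C := G)) => //.
  exact: measurable_realfun.measurable_fun_cvg mf ff.
rewrite -Rintegral_itv_bndo_bndc//.
have := bounded_cvg_Rintegral (mu := lebesgue_measure) mD muD mf fG ff.
apply: cvg_trans; apply: near_eq_cvg; near=> p.
have /andP[kp1 _] : (k p)%:R * harmonic p <= th <= (k p).+1%:R * harmonic p.
  by near: p.
rewrite Rintegral_sum//; last first.
  move=> i; apply: (bounded_integrable (C := G)) => //.
    exact: measurable_funM.
  move=> x _; rewrite normrM -[leRHS]mulr1 ler_pM//.
  by rewrite ger0_norm ?indicE// lern1 leq_b1.
apply: eq_bigr => i _; rewrite RintegralZ_indic//.
congr (_ * _).
have ik : i.+1%:R * harmonic p <= th.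
  by apply: le_trans kp1; rewrite ler_pM2r// ler_nat.
rewrite (_ : _ `&` D =
  `[i%:R * harmonic p, i.+1%:R * harmonic p[%classic); last first.
  apply/setIidl => x /=; rewrite /D /= !in_itv /= => /andP[x1 x2].
  rewrite (lt_le_trans x2 ik) andbT; apply: le_trans x1.
  by rewrite mulr_ge0// ltW.
transitivity (fine (lebesgue_measure
  (`[i%:R * harmonic p, i.+1%:R * harmonic p[%classic : set R))) => //.
rewrite lebesgue_measure_itv /= lte_fin ltr_pM2r// ltr_nat ltnSn -EFinB /=.
by rewrite -mulrBl -natrB// subSnn mul1r.
Unshelve. all: by end_near. Qed.

End Riemann.

(** * Hitting times along a path and along its grid samples *)

Section HittingFunctional.
Variables (R : realType) (S : finType) (hit : pred S) (g : S -> R).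
Variables (delta : S -> R[i]) (s : R[i]).
Implicit Types (y : nat -> S) (h : R).

(* Junk value 0 if y never hits. *)
Definition first_hit y : nat :=
  if pselect (exists i, hit (y i)) is left ex then ex_minn ex else 0%N.

Lemma first_hitP y : (exists i, hit (y i)) ->
  hit (y (first_hit y)) /\ forall i, hit (y i) -> (first_hit y <= i)%N.
Proof.
rewrite /first_hit; case: pselect => // ex _.
by case: ex_minnP => m ? ?; split.
Qed.

Definition step_cost h x : R[i] := cexp (- s * (h * g x)%:C%C).

(* The cost of the hitting step itself is not charged, so that the cost sum *)
(* below is a right Riemann sum over an interval contained in [0, theta].    *)
Fixpoint hit_value h (l : seq S) : R[i] :=
  if l is x :: l' then
    if hit x then delta x else step_cost h x * hit_value h l'
  else 0.

(** Infinite-horizon counterpart of [hit_value], in closed form so that its exponent can be compared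
    with the cost integral. *)
Definition grid_value h y : R[i] :=
  if `[< exists i, hit (y i) >] then
    cexp (- s * (\sum_(i < first_hit y) g (y i) * h)%:C%C) *
      delta (y (first_hit y))
  else 0.

Lemma hit_value_nohit h y M :
  (forall i, ~~ hit (y i)) -> hit_value h (mkseq y M) = 0.
Proof.
elim: M y => [//|M IH] y ny.
rewrite /mkseq /= (negbTE (ny 0%N)) -[1%N]addn0 iotaDl -map_comp.
by rewrite (IH (y \o succn)) ?mulr0// => i; exact: ny.
Qed.

Lemma hit_value_first h y k M : hit (y k) ->
  (forall i, (i < k)%N -> ~~ hit (y i)) -> (k < M)%N ->
  hit_value h (mkseq y M) =
  cexp (- s * (\sum_(i < k) g (y i) * h)%:C%C) * delta (y k).
Proof.
elim: k y M => [|k IH] y [//|M] yk nk kM.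
  by rewrite /mkseq /= yk big_ord0 mulr0 cexp0 mul1r.
rewrite /mkseq /= (negbTE (nk 0%N _))// -[1%N]addn0 iotaDl -map_comp.
rewrite (IH (y \o succn)) //; last by move=> i ik; exact: nk.
rewrite mulrA -cexpD -mulrDr -raddfD /= big_ord_recl mulrC.
by rewrite [in RHS]mulrC (mulrC (g _)).
Qed.

(** The sequence is eventually constant: from the first hit on, or throughout when there is none. *)
Lemma hit_value_cvg h y :
  ccvg (fun M => hit_value h (mkseq y M)) (grid_value h y).
Proof.
apply: ccvg_near_cst; rewrite /grid_value; case: asboolP => [ex|nex].
  have [hf fmin] := first_hitP ex.
  exists (first_hit y).+1 => // M /= kM; apply: hit_value_first => // i.
  by apply: contraTN => /fmin; rewrite -leqNgt.
apply: nearW => M; apply: hit_value_nohit => i.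
by apply/negP => yi; apply: nex; exists i.
Qed.

Hypothesis s0 : 0 <= complex.Re s.
Hypothesis g0 : forall x, 0 <= g x.
Hypothesis delta1 : forall x, sqmod (delta x) <= 1.

(** The exponent lies in the closed left half-plane. All later domination by 1 rests on this
    bound. *)
Lemma sqmod_cost (a : R) : 0 <= a -> sqmod (cexp (- s * a%:C%C)) <= 1.
Proof.
move=> a0; apply: sqmod_cexp_le1.
by rewrite cReM /= mulr0 subr0 raddfN/= mulNr oppr_le0 mulr_ge0.
Qed.

Lemma sqmod_hit_value h l : 0 <= h -> sqmod (hit_value h l) <= 1.
Proof.
move=> h0; elim: l => [|x l IH] /=; first by rewrite /sqmod /= expr0n /= addr0.
case: ifP => _; first exact: delta1.
by rewrite sqmodM mulr_ile1 ?sqmod_ge0// sqmod_cost// mulr_ge0.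
Qed.

Lemma sqmod_grid_value h y : 0 <= h -> sqmod (grid_value h y) <= 1.
Proof.
move=> h0; rewrite /grid_value; case: ifP => _.
  rewrite sqmodM mulr_ile1 ?sqmod_ge0// sqmod_cost// sumr_ge0// => i _.
  by rewrite mulr_ge0.
by rewrite /sqmod /= expr0n /= addr0.
Qed.

Definition hitting (z : R -> S) : \bar R :=
  ereal_inf [set t%:E | t in [set t : R | 0 < t /\ hit (z t)]].

Lemma hittingP (z : R -> S) : (hitting z < +oo)%E ->
  [/\ 0 <= fine (hitting z),
    forall t, 0 < t -> hit (z t) -> fine (hitting z) <= t &
    forall e, 0 < e -> exists t,
      [/\ 0 < t, fine (hitting z) <= t < fine (hitting z) + e & hit (z t)]].
Proof.
move=> zoo.
have z0 : (0 <= hitting z)%E.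
  by apply: le_ereal_inf_tmp => _ [t [t0 _] <-]; rewrite lee_fin ltW.
have zE : hitting z = (fine (hitting z))%:E by rewrite fineK// ge0_fin_numE.
have lb t : 0 < t -> hit (z t) -> fine (hitting z) <= t.
  move=> t0 ht; rewrite -lee_fin -zE; apply: ereal_inf_lbound.
  by exists t.
split => //; first by rewrite fine_ge0.
move=> e e0.
have /ereal_inf_lt[_ [t [t0 ht] <-]] :
    (hitting z < (fine (hitting z) + e)%:E)%E.
  by rewrite [X in (X < _)%E]zE lte_fin ltrDl.
by rewrite lte_fin => te; exists t; rewrite lb.
Qed.

(** The path is constant just after the hitting time, so a fine enough grid has a sample there, and
    its first hit sees the same state. No sample before the hitting time is a hit, so the sampled
    cost is a right Riemann sum up to that time. If the hitting time is infinite, no sample hits and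
    both sides vanish. *)
Lemma grid_value_cvg (z : R -> S) :
  (forall u, 0 <= u -> \forall v \near u^'+, z v = z u) ->
  ccvg (fun p => grid_value (harmonic p) (fun i => z (i.+1%:R * harmonic p)))
    (cexp (- s *
       (\int[lebesgue_measure]_(u in `[0, fine (hitting z)]) g (z u))%:C%C) *
     (if (hitting z < +oo)%E then delta (z (fine (hitting z))) else 0)).
Proof.
move=> zr.
have hp0 p : (0 : R) < harmonic p by rewrite /harmonic invr_gt0 ltr0n.
case: ifPn => [zoo|nzoo]; last first.
  rewrite mulr0; apply: ccvg_near_cst; apply: nearW => p.
  rewrite /grid_value; case: asboolP => // -[i hi]; case/negP: nzoo.
  apply/ereal_inf_ltP; exists (i.+1%:R * harmonic p)%:E; last by rewrite ltry.
  by exists (i.+1%:R * harmonic p) => //; split => //; rewrite mulr_gt0.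
have [th0 thlb thadh] := hittingP zoo.
move: (fine (hitting z)) th0 thlb thadh => th th0 thlb thadh.
have [e e0 he] := near_right_ex (zr _ th0).
(* Some hit lies in [th, th + e), where [z] is constant; this also covers th = 0. *)
have hth : hit (z th).
  by have [t [t0 tth ht]] := thadh _ e0; rewrite -(he t).
pose y p i := z (i.+1%:R * harmonic p).
have key : \forall p \near \oo, [/\ exists i, hit (y p i),
   (first_hit (y p))%:R * harmonic p <= th <=
   (first_hit (y p)).+1%:R * harmonic p & y p (first_hit (y p)) = z th].
  near=> p.
  have hpe : harmonic p < e.
    by near: p; exact: (near_infty_natSinv_lt (PosNum e0)).
  (* Sample t is taken at time (t + 1) harmonic p, the first grid time after [th]; it falls in the
     interval of constancy and is therefore a hit. *)
  have /andP[] : (Num.truncn (th / harmonic p))%:R <= th / harmonic p <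
      (Num.truncn (th / harmonic p)).+1%:R.
    by apply: truncn_itv; rewrite divr_ge0// ltW.
  set t := Num.truncn _.
  rewrite ler_pdivlMr// ltr_pdivrMr// => t1 t2.
  have t3 : t.+1%:R * harmonic p <= th + harmonic p.
    by rewrite -natr1 mulrDl mul1r lerD2r.
  have t4 : t.+1%:R * harmonic p < th + e.
    by apply: le_lt_trans t3 _; rewrite ltrD2l.
  have ht : hit (y p t) by rewrite /y he// ltW.
  have ex : exists i, hit (y p i) by exists t.
  have [hf fmin] := first_hitP ex.
  have ft := fmin _ ht.
  have f1 : th <= (first_hit (y p)).+1%:R * harmonic p.
    by apply: thlb => //; rewrite mulr_gt0.
  split => //.
    rewrite f1 andbT; apply: le_trans t1.
    by rewrite ler_pM2r// ler_nat.
  rewrite /y he// f1/=; apply: le_lt_trans t4.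
  by rewrite ler_pM2r// ler_nat ltnS.
have sumcvg : \sum_(i < first_hit (y p)) g (y p i) * harmonic p @[p --> \oo]
    --> \int[lebesgue_measure]_(u in `[0, th]) g (z u).
  (* The state space is finite, so the sum of all values of [g] bounds it. *)
  apply: (@cvg_Riemann_right _ (g \o z) (\sum_x g x)) => //.
  - move=> u; rewrite /= ger0_norm// (bigD1 (z u))//= lerDl.
    by rewrite sumr_ge0.
  - by move=> u u0; near do rewrite /=; apply: filterS (zr _ u0) => v /= ->.
  - by apply: filterS key => p [].
have := ccvgM (ccvg_cexp (ccvgM (ccvg_cst (- s)) (ccvg_real sumcvg)))
  (ccvg_cst (delta (z th))).
apply: ccvg_near_eq; apply: filterS key => p [ex _ yE].
by rewrite /grid_value; case: asboolP => // _; rewrite -yE.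
Unshelve. all: by end_near. Qed.

End HittingFunctional.

(** * Expectations for the sampled chain *)

Section ComplexExpectation.
Variables (R : realType) (d : measure_display) (T : measurableType d).
Variable mu : probability T R.

Definition cmeasurable (f : T -> R[i]) : Prop :=
  measurable_fun setT (fun w => complex.Re (f w)) /\
  measurable_fun setT (fun w => complex.Im (f w)).

Lemma cmeasurable_cvg (f_ : nat -> T -> R[i]) (f : T -> R[i]) :
  (forall n, cmeasurable (f_ n)) -> (forall w, ccvg (f_ ^~ w) (f w)) ->
  cmeasurable f.
Proof.
move=> mf_ f_f; split.
  apply: (@measurable_realfun.measurable_fun_cvg _ _ _ _
    (fun n w => complex.Re (f_ n w))); first by move=> n; have [] := mf_ n.
  by move=> w _; have [] := f_f w.
apply: (@measurable_realfun.measurable_fun_cvg _ _ _ _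
  (fun n w => complex.Im (f_ n w))); first by move=> n; have [] := mf_ n.
by move=> w _; have [] := f_f w.
Qed.

Lemma cexpectation_cvg (f_ : nat -> T -> R[i]) (f : T -> R[i]) :
  (forall n, cmeasurable (f_ n)) -> (forall n w, sqmod (f_ n w) <= 1) ->
  (forall w, ccvg (f_ ^~ w) (f w)) ->
  ccvg (fun n => cexpectation mu (f_ n)) (cexpectation mu f).
Proof.
move=> mf_ f_1 f_f.
have muT : (mu setT < +oo)%E by rewrite probability_setT ltry.
split; rewrite /cexpectation /=.
- apply: (bounded_cvg_Rintegral (C := 1)) => //.
  + by move=> n; have [] := mf_ n.
  + by move=> n w _; exact: Re_le1.
  + by move=> w _; have [] := f_f w.
- apply: (bounded_cvg_Rintegral (C := 1)) => //.
  + by move=> n; have [] := mf_ n.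
  + by move=> n w _; exact: Im_le1.
  + by move=> w _; have [] := f_f w.
Qed.

Lemma Re_sum_indic (I : Type) (r : seq I) (a : I -> R[i]) (E : I -> set T) w :
  complex.Re (\sum_(i <- r) a i * (\1_(E i) w)%:C%C) =
  \sum_(i <- r) complex.Re (a i) * \1_(E i) w.
Proof.
by rewrite raddf_sum; apply: eq_bigr => i _ /=; rewrite cReM/= mulr0 subr0.
Qed.

Lemma Im_sum_indic (I : Type) (r : seq I) (a : I -> R[i]) (E : I -> set T) w :
  complex.Im (\sum_(i <- r) a i * (\1_(E i) w)%:C%C) =
  \sum_(i <- r) complex.Im (a i) * \1_(E i) w.
Proof.
by rewrite raddf_sum; apply: eq_bigr => i _ /=; rewrite cImM/= mulr0 add0r.
Qed.

Lemma cmeasurable_sum_indic (I : Type) (r : seq I) (a : I -> R[i])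
    (E : I -> set T) : (forall i, measurable (E i)) ->
  cmeasurable (fun w => \sum_(i <- r) a i * (\1_(E i) w)%:C%C).
Proof.
move=> mE; split.
  under eq_fun do rewrite Re_sum_indic.
  by apply: measurable_sum => i; exact: measurable_funM.
under eq_fun do rewrite Im_sum_indic.
by apply: measurable_sum => i; exact: measurable_funM.
Qed.

Lemma cexpectation_sum_indic (I : Type) (r : seq I) (a : I -> R[i])
    (E : I -> set T) : (forall i, measurable (E i)) ->
  cexpectation mu (fun w => \sum_(i <- r) a i * (\1_(E i) w)%:C%C) =
  \sum_(i <- r) a i * (fine (mu (E i)))%:C%C.
Proof.
move=> mE; have muT : (mu setT < +oo)%E by rewrite probability_setT ltry.
have int (b : R) i : mu.-integrable setT (EFin \o (fun w => b * \1_(E i) w)).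
  apply: (bounded_integrable (C := `|b|)) => //; first exact: measurable_funM.
  move=> x _; rewrite normrM -[leRHS]mulr1 ler_pM//.
  by rewrite ger0_norm ?indicE// lern1 leq_b1.
have H (b : I -> R) : \int[mu]_w (\sum_(i <- r) b i * \1_(E i) w) =
    \sum_(i <- r) b i * fine (mu (E i)).
  rewrite Rintegral_sum//; apply: eq_bigr => i _.
  by rewrite RintegralZ_indic// setIT.
apply/eqP; rewrite eq_complex /cexpectation /=.
apply/andP; split; apply/eqP.
  under eq_Rintegral do rewrite Re_sum_indic.
  rewrite H raddf_sum; apply: eq_bigr => i _ /=.
  by rewrite cReM/= mulr0 subr0.
under eq_Rintegral do rewrite Im_sum_indic.
rewrite H raddf_sum; apply: eq_bigr => i _ /=.
by rewrite cImM/= mulr0 add0r.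
Qed.

End ComplexExpectation.

(** * Finite sample paths and first-step analysis *)

Section Paths.
Variable S : finType.

Fixpoint paths (M : nat) : seq (seq S) :=
  if M is M'.+1 then [seq y :: l | y <- index_enum S, l <- paths M']
  else [:: [::]].

(** Each list occurs exactly once among the [paths] of its length. Hence any function of finitely
    many samples is a simple function, whose expectation is a finite sum. *)
Lemma sum_paths_eq (V : pzRingType) (F : seq S -> V) (l : seq S) :
  \sum_(l' <- paths (size l)) F l' * (l == l')%:R = F l.
Proof.
elim: l F => [|x l IH] F /=; first by rewrite big_seq1 mulr1.
rewrite big_allpairs_dep (bigD1 x)//= -[RHS](IH (F \o cons x)).
rewrite [X in _ + X]big1 ?addr0 => [|y yx].
  by apply: eq_bigr => l' _; rewrite eqseq_cons eqxx.
rewrite big1// => l' _.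
by rewrite eqseq_cons eq_sym (negbTE yx) mulr0.
Qed.

End Paths.

Section GridChain.
Variables (R : realType) (N : nat) (K : nat -> nat).
Variable Q : forall n m : nat, 'M[R]_((K n).+1, (K m).+1).
Variables (d : measure_display) (T : measurableType d).
Variable P : forall n : nat, 'I_(K n).+1 -> probability T R.
Variable Z : R -> T -> state N K.
Hypothesis hZ : is_CTMC P Z Q.
Local Notation S := (state N K).
Implicit Types (x y : S) (l : seq S) (h : R).

(* The sample at time 0 is left out, as in the definition of theta. *)
Definition grid h (w : T) (i : nat) : S := Z (i.+1%:R * h) w.

Definition path_event h l : set T := [set w | mkseq (grid h w) (size l) = l].

Lemma path_event0 h : path_event h [::] = setT.
Proof. by apply/seteqP; split. Qed.

Lemma path_event_rcons h l y : path_event h (rcons l y) =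
  path_event h l `&` [set w | Z ((size l).+1%:R * h) w = y].
Proof.
apply/seteqP; split => w; rewrite /path_event /= size_rcons mkseqS.
  by move=> /eqP; rewrite eqseq_rcons => /andP[/eqP ? /eqP ?]; split.
by move=> [-> <-].
Qed.

(** This makes a sample path admissible as the past event in [ctmc_markov]. *)
Lemma history_path_event h l (u : R) : 0 <= h -> (size l)%:R * h <= u ->
  history Z u (path_event h l).
Proof.
move=> h0; elim/last_ind: l => [|l y IH] lu.
  rewrite path_event0; exact: (@measurableT _ (g_sigma_algebraType _)).
rewrite path_event_rcons size_rcons in lu *.
apply: (@measurableI _ (g_sigma_algebraType _)).
  by apply: IH; apply: le_trans lu; rewrite ler_wpM2r// ler_nat.
apply: sub_sigma_algebra; exists ((size l).+1%:R * h), y; split => //.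
by rewrite lu andbT mulr_ge0.
Qed.

Lemma measurable_path_event h l : 0 <= h -> measurable (path_event h l).
Proof.
move=> h0; elim/last_ind: l => [|l y IH]; first by rewrite path_event0.
rewrite path_event_rcons; apply: measurableI => //.
by apply: (ctmc_measurable hZ); rewrite mulr_ge0.
Qed.

Local Notation p := (transition P Z).

Fixpoint path_weight h x l : R :=
  if l is y :: l' then p h x y * path_weight h y l' else 1.

Lemma path_weight_rcons h x l y :
  path_weight h x (rcons l y) = path_weight h x l * p h (last x l) y.
Proof.
by elim: l x => [|z l IH] x /=; rewrite ?mulr1 ?mul1r// IH mulrA.
Qed.

Lemma law_transition t x y : 0 <= t ->
  law P x [set w | Z t w = y] = (p t x y)%:E.
Proof.
move=> t0; rewrite /transition fineK// fin_num_measure//.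
exact: (ctmc_measurable hZ).
Qed.

(** Induction on the last sample, with the Markov property at the preceding grid time; for a single
    sample this is the definition of [transition]. *)
Lemma law_path_event h x l : 0 <= h ->
  law P x (path_event h l) = (path_weight h x l)%:E.
Proof.
move=> h0; elim/last_ind: l => [|l y IH].
  by rewrite path_event0 probability_setT.
case/lastP: l IH => [_|l z IH].
  rewrite path_event_rcons path_event0 setTI /= mul1r mulr1.
  exact: law_transition.
rewrite path_weight_rcons last_rcons EFinM -IH.
(* [ctmc_markov] intersects the past with the present state, which the path event already fixes. *)
have E : path_event h (rcons l z) `&` [set w | Z ((size l).+1%:R * h) w = z] =
    path_event h (rcons l z).
  by rewrite path_event_rcons -setIA setIid.
have hu : 0 <= (size l).+1%:R * h by rewrite mulr_ge0.
rewrite -[in RHS]E -(ctmc_markov hZ x z y hu h0); last first.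
  by apply: history_path_event => //; rewrite size_rcons.
rewrite E [in LHS]path_event_rcons size_rcons.
by rewrite -[(size l).+2%:R]natr1 mulrDl mul1r.
Qed.

Lemma sum_transition h x : 0 <= h -> \sum_y p h x y = 1.
Proof.
move=> h0; have mE y : measurable [set w | Z h w = y].
  exact: (ctmc_measurable hZ).
have muT : (law P x setT < +oo)%E by rewrite probability_setT ltry.
transitivity (\int[law P x]_w (\sum_y 1 * \1_[set w | Z h w = y] w)).
  rewrite Rintegral_sum//; last first.
    move=> y; apply: (bounded_integrable (C := 1)) => //.
      exact: measurable_funM.
    by move=> w _; rewrite mul1r ger0_norm ?indicE// lern1 leq_b1.
  by apply: eq_bigr => y _; rewrite RintegralZ_indic// setIT mul1r.
transitivity (\int[law P x]_w (1 : R)).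
  apply: eq_Rintegral => w _.
  rewrite (bigD1 (Z h w))//= indicE mem_set//= mulr1 big1 ?addr0// => y yZ.
  by rewrite indicE memNset ?mulr0//= => /esym/eqP; apply/negP.
rewrite Rintegral_cst// mul1r -[RHS]/(fine 1%E).
by congr fine; exact: probability_setT.
Qed.

Lemma sum_path_weight h x M : 0 <= h ->
  \sum_(l <- paths S M) path_weight h x l = 1.
Proof.
move=> h0; elim: M x => [|M IH] x /=; first by rewrite big_seq1.
rewrite big_allpairs_dep -[RHS](sum_transition x h0); apply: eq_bigr => y _.
by rewrite -mulr_sumr IH mulr1.
Qed.

Lemma path_functionE h (F : seq S -> R[i]) M w :
  F (mkseq (grid h w) M) =
  \sum_(l <- paths S M) F l *
     (\1_[set w | mkseq (grid h w) M = l] w)%:C%C.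
Proof.
rewrite -[LHS](@sum_paths_eq _ _ F) size_mkseq; apply: eq_bigr => l _.
congr (_ * _); rewrite indicE; case: eqVneq => [<-|ne].
  by rewrite mem_set.
by rewrite memNset//; apply/eqP.
Qed.

Lemma pathsP M l : l \in paths S M -> size l = M.
Proof.
elim: M l => [|M IH] l /=; first by rewrite inE => /eqP ->.
by move=> /allpairsP[[y l'] /= [_ /IH <- ->]].
Qed.

Lemma measurable_path_set h M l : 0 <= h ->
  measurable [set w | mkseq (grid h w) M = l].
Proof.
move=> h0; case: (eqVneq (size l) M) => [<-|lM].
  exact: measurable_path_event.
rewrite (_ : mkset _ = set0)//; apply/seteqP; split => // w /= wl.
by move: lM; rewrite -wl size_mkseq eqxx.
Qed.

Lemma cmeasurable_path h (F : seq S -> R[i]) M : 0 <= h ->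
  cmeasurable (fun w => F (mkseq (grid h w) M)).
Proof.
move=> h0; under eq_fun do rewrite path_functionE.
by apply: cmeasurable_sum_indic => l; exact: measurable_path_set.
Qed.

Lemma cexpectation_path h (F : seq S -> R[i]) M x : 0 <= h ->
  cexpectation (law P x) (fun w => F (mkseq (grid h w) M)) =
  \sum_(l <- paths S M) F l * (path_weight h x l)%:C%C.
Proof.
move=> h0; under eq_fun do rewrite path_functionE.
rewrite cexpectation_sum_indic; last by move=> l; exact: measurable_path_set.
apply: eq_big_seq => l /pathsP <-; congr (_ * _%:C%C).
by rewrite -[RHS]/(fine (EFin _)) -law_path_event.
Qed.

Variables (hit : pred S) (g : S -> R) (delta : S -> R[i]) (s : R[i]).
Hypothesis s0 : 0 <= complex.Re s.
Hypothesis g0 : forall x, 0 <= g x.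
Hypothesis delta1 : forall x, sqmod (delta x) <= 1.

Definition horizon_expectation h M x : R[i] := cexpectation (law P x)
  (fun w => hit_value hit g delta s h (mkseq (grid h w) M)).

Definition grid_expectation h x : R[i] := cexpectation (law P x)
  (fun w => grid_value hit g delta s h (grid h w)).

(** The weight of a path factors through its first sample y, and the rest is the same sum started
    from y with a horizon shorter by one. If y is a hit, the remaining weights sum to 1. *)
Lemma horizon_step h x M : 0 <= h ->
  horizon_expectation h M.+1 x = \sum_y (p h x y)%:C%C *
    (if hit y then delta y else step_cost g s h y * horizon_expectation h M y).
Proof.
move=> h0; rewrite {1}/horizon_expectation cexpectation_path//.
transitivity (\sum_y \sum_(l <- paths S M)
    hit_value hit g delta s h (y :: l) * (path_weight h x (y :: l))%:C%C).
  by rewrite [LHS]big_allpairs_dep.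
apply: eq_bigr => y _.
transitivity ((p h x y)%:C%C * \sum_(l <- paths S M)
    (hit_value hit g delta s h (y :: l) * (path_weight h y l)%:C%C)).
  by rewrite mulr_sumr; apply: eq_bigr => l _; rewrite mulrCA [in LHS]rmorphM.
congr (_ * _) => /=; case: (hit y).
  by rewrite -mulr_sumr -rmorph_sum/= sum_path_weight// mulr1.
rewrite /horizon_expectation cexpectation_path// mulr_sumr.
by apply: eq_bigr => l _; rewrite mulrA.
Qed.

Lemma cmeasurable_grid_value h : 0 <= h ->
  cmeasurable (fun w => grid_value hit g delta s h (grid h w)).
Proof.
move=> h0; apply: (cmeasurable_cvg (f_ := fun M w =>
  hit_value hit g delta s h (mkseq (grid h w) M))).
  by move=> M; exact: cmeasurable_path.
by move=> w; exact: hit_value_cvg.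
Qed.

(** Both sides of [horizon_step] converge as the horizon grows, by bounded convergence. *)
Lemma grid_step h x : 0 <= h ->
  grid_expectation h x = \sum_y (p h x y)%:C%C *
    (if hit y then delta y else step_cost g s h y * grid_expectation h y).
Proof.
move=> h0.
have FL z : ccvg (fun M => horizon_expectation h M z) (grid_expectation h z).
  apply: cexpectation_cvg.
  - by move=> M; exact: cmeasurable_path.
  - by move=> M w; exact: sqmod_hit_value.
  - by move=> w; exact: hit_value_cvg.
apply: (ccvg_unique (ccvg_shift (FL x))).
apply: (ccvg_eq (fun M => esym (horizon_step x M h0))).
apply: ccvg_sum => y; apply: ccvgM; first exact: ccvg_cst.
by case: ifP => _; [exact: ccvg_cst|apply: ccvgM => //; exact: ccvg_cst].
Qed.

End GridChain.

(** * The limit of vanishing step *)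

Section GeneratorEquation.
Variables (R : realType) (N : nat) (K : nat -> nat).
Variable Q : forall n m : nat, 'M[R]_((K n).+1, (K m).+1).
Variables (d : measure_display) (T : measurableType d).
Variable P : forall n : nat, 'I_(K n).+1 -> probability T R.
Variable Z : R -> T -> state N K.
Hypothesis hZ : is_CTMC P Z Q.
Local Notation S := (state N K).
Variables (hit : pred S) (g : S -> R) (delta : S -> R[i]) (s : R[i]).
Hypothesis s0 : 0 <= complex.Re s.
Hypothesis g0 : forall x, 0 <= g x.
Hypothesis delta1 : forall x, sqmod (delta x) <= 1.
Implicit Types x y : S.

(** Common form of the entries of [LST], for any hit set, cost rate and terminal value; [LSTE]
    specialises it. *)
Definition hitting_value x : R[i] := cexpectation (law P x) (fun w =>
  let theta := hitting hit (Z ^~ w) in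
  cexp (- s *
    (\int[lebesgue_measure]_(u in `[0, fine theta]) g (Z u w))%:C%C) *
  (if (theta < +oo)%E then delta (Z (fine theta) w) else 0)).

Let h (n : nat) : R := harmonic n.
Let h0 n : 0 <= h n. Proof. by rewrite /h /harmonic invr_ge0. Qed.
Let h_neq0 n : h n != 0. Proof. by rewrite /h /harmonic invr_neq0. Qed.

Let L n x := grid_expectation P Z hit g delta s (h n) x.

Lemma grid_hitting_value_cvg x : ccvg (L ^~ x) (hitting_value x).
Proof.
apply: cexpectation_cvg.
- by move=> n; exact: (cmeasurable_grid_value hZ).
- by move=> n w; exact: sqmod_grid_value.
- move=> w; apply: (@grid_value_cvg _ _ hit g delta s g0 (Z ^~ w)).
  by move=> u u0; exact: (ctmc_right_continuous hZ).
Qed.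

(** With the factor [E] and the boundary values [B], [grid_step] says that L n x is the sum over y
    of p n x y times E n y times B n y. *)
Let E n y : R[i] := if hit y then 1 else step_cost g s (h n) y.

Let B n y : R[i] := if hit y then delta y else L n y.

Let p n x y := (transition P Z (h n) x y)%:C%C.

Lemma step_cost_cvg y : ccvg (fun n => step_cost g s (h n) y) 1.
Proof.
rewrite -(@cexp0 R) -(mulr0 (- s)); apply: ccvg_cexp.
apply: ccvgM; first exact: ccvg_cst.
apply: (@ccvg_real _ (fun n => h n * g y) 0).
rewrite -(mul0r (g y)); apply: cvgM; last exact: cvg_cst.
exact: cvg_harmonic.
Qed.

Lemma step_cost_diff_quotient y :
  ccvg (fun n => (step_cost g s (h n) y - 1) * (h n)^-1%:C%C)
    (- s * (g y)%:C%C).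
Proof.
apply: ccvg_eq (cexp_diff_quotient (- s * (g y)%:C%C)) => n.
rewrite /step_cost; congr ((cexp _ - 1) * _).
by rewrite mulrCA [in RHS]rmorphM.
Qed.

Lemma rate_cvg x y :
  ccvg (fun n => (p n x y - (x == y)%:R) * (h n)^-1%:C%C) (rate Q x y)%:C%C.
Proof.
have gen : (transition P Z t x y - (x == y)%:R) / t @[t --> 0^'+] -->
    rate Q x y.
  exact: (ctmc_generator hZ).
have /cvg_at_rightP/(_ h) := gen.
have hh n : 0 < h n by rewrite lt_neqAle eq_sym h_neq0 h0.
move=> /(_ (conj hh cvg_harmonic))/ccvg_real; apply: ccvg_eq => n.
rewrite rmorphM rmorphB /= /p; congr ((_ - _) * _).
by case: (x == y).
Qed.

(** Write p E - 1 as (p - 1) E + 1 (E - 1), with 1 the identity matrix: the first term yields the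
    rate, the second the derivative of the step cost. At a hit [y] the second is absent because x
    differs from y. *)
Lemma taboo_rate_cvg x y : ~~ hit x ->
  ccvg (fun n => (p n x y * E n y - (x == y)%:R) * (h n)^-1%:C%C)
    ((rate Q x y)%:C%C + (x == y)%:R * (- s * (g x)%:C%C)).
Proof.
move=> hx; case hy : (hit y).
  have xy : (x == y) = false by apply: contraNF hx => /eqP ->.
  have := rate_cvg x y; rewrite xy mul0r addr0.
  by apply: ccvg_eq => n; rewrite /E hy mulr1.
have h1 : ccvg (fun n => (p n x y - (x == y)%:R) * (h n)^-1%:C%C *
    step_cost g s (h n) y) (rate Q x y)%:C%C.
  rewrite -[X in ccvg _ X]mulr1; apply: ccvgM; first exact: rate_cvg.
  exact: step_cost_cvg.
have h2 : ccvg (fun n => (x == y)%:R *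
    ((step_cost g s (h n) y - 1) * (h n)^-1%:C%C))
    ((x == y)%:R * (- s * (g x)%:C%C)).
  case: eqVneq => [->|_].
    by apply: ccvgM; [exact: ccvg_cst|exact: step_cost_diff_quotient].
  by rewrite mul0r; apply: ccvg_eq (ccvg_cst 0) => n; rewrite mul0r.
apply: ccvg_eq (ccvgD h1 h2) => n; rewrite /E hy; ring.
Qed.

Lemma generator_equation x : ~~ hit x ->
  \sum_y (rate Q x y)%:C%C * (if hit y then delta y else hitting_value y) =
  s * (g x)%:C%C * hitting_value x.
Proof.
move=> hx; pose Bl y := if hit y then delta y else hitting_value y.
have Bcvg y : ccvg (B ^~ y) (Bl y).
  rewrite /B /Bl; case: (hit y); first exact: ccvg_cst.
  exact: grid_hitting_value_cvg.
(* [grid_step] brought to one side and divided by the step size; since [x] is not a hit, [B n x] is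
   [L n x]. *)
have step n :
    \sum_y (p n x y * E n y - (x == y)%:R) * (h n)^-1%:C%C * B n y = 0.
  transitivity ((h n)^-1%:C%C * \sum_y (p n x y * E n y - (x == y)%:R) * B n y).
    by rewrite mulr_sumr; apply: eq_bigr => y _; rewrite mulrAC mulrC.
  under eq_bigr do rewrite mulrBl.
  rewrite sumrB (bigD1 x (F := fun y => (x == y)%:R * _))//= eqxx mul1r.
  rewrite [X in _ - (_ + X)]big1 => [|y /negbTE yx]; last first.
    by rewrite eq_sym yx mul0r.
  rewrite addr0 {2}/B (negbTE hx) /L (grid_step hZ)//.
  apply/eqP; rewrite mulf_eq0 subr_eq0; apply/orP; right; apply/eqP.
  apply: eq_bigr => y _; rewrite -mulrA /E /B.
  by case: (hit y); rewrite ?mul1r.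
have := ccvg_sum (index_enum S)
  (fun y => ccvgM (taboo_rate_cvg y hx) (Bcvg y)).
move=> /(ccvg_eq step)/(ccvg_unique (ccvg_cst 0))/esym.
under eq_bigr do rewrite mulrDl.
rewrite big_split/= [X in _ + X](bigD1 x)//= eqxx mul1r {2}/Bl (negbTE hx).
rewrite [X in _ + (_ + X)]big1 => [|y /negbTE yx]; last first.
  by rewrite eq_sym yx !mul0r.
by rewrite addr0 => /eqP; rewrite addr_eq0 => /eqP ->; rewrite !mulNr opprK.
Qed.

End GeneratorEquation.

(** * Elimination of the levels *)

Section Blocks.
Variables (R : realType) (N : nat) (K : nat -> nat).
Variable Q : forall n m : nat, 'M[R]_((K n).+1, (K m).+1).
Hypothesis hQ : is_LDQBD_generator N Q.
Variables (d : measure_display) (T : measurableType d).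
Variable P : forall n : nat, 'I_(K n).+1 -> probability T R.
Variable Z : R -> T -> state N K.
Hypothesis hZ : is_CTMC P Z Q.
Variable c : forall n : nat, 'I_(K n).+1 -> R.
Hypothesis hc : forall (n : nat) (i : 'I_(K n).+1), (n <= N)%N -> 0 <= c i.
Variables (A : pred nat) (s : R[i]).
Hypothesis hs : 0 <= complex.Re s.

(** [Ordinal ha] reduces to the level [a], so the phase needs no transport. *)
Definition mkstate (a : nat) (ha : (a < N.+1)%N) (i : 'I_(K a).+1) :
    state N K :=
  Tagged (fun n : 'I_N.+1 => 'I_(K n).+1) (i : 'I_(K (Ordinal ha)).+1).

Definition cost_rate (x : state N K) : R :=
  c (tagged x) * (A (level x))%:R.

(** Phases are compared as natural numbers, since their type depends on the level. *)
Definition phase_indic (j : nat) (x : state N K) : R[i] := (phase x == j)%:R.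

Lemma LSTE (a m : nat) (ha : (a < N.+1)%N) (i : 'I_(K a).+1) (j : 'I_(K m).+1) :
  LST P Z c A s a m i j =
  hitting_value P Z (fun x => level x == m) cost_rate (phase_indic j) s
    (mkstate ha i).
Proof.
rewrite mxE; congr (cexpectation _ _); apply/funext => w.
have -> : hitting_time Z m w = hitting (fun x => level x == m) (Z ^~ w).
  congr (ereal_inf (_ @` _)); apply/seteqP.
  by split => t [t0 /eqP ht]; split => //; apply/eqP.
by congr (_ * _); rewrite /phase_indic; case: ifP.
Qed.

(* The transforms towards level m, seen as a function of the starting level *)
(* that takes the value 1 at level m itself.                                *)
Definition LST_bd (m b : nat) : 'M[R[i]]_((K b).+1, (K m).+1) :=
  \matrix_(i, j) if b == m then (val i == val j)%:R else LST P Z c A s b m i j.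

Lemma LST_bd_id m : LST_bd m m = 1%:M.
Proof. by apply/matrixP => i j; rewrite !mxE eqxx. Qed.

Lemma LST_bd_neq m b : b != m -> LST_bd m b = LST P Z c A s b m.
Proof. by move=> /negbTE bm; apply/matrixP => i j; rewrite mxE bm. Qed.

(** Entry by entry this is [generator_equation] with level m as hit set and the indicator of phase j
    as terminal value, which the identity block of [LST_bd] encodes. The sum over states is
    regrouped by level and phase. *)
Lemma block_equation (a m : nat) : (a <= N)%N -> a != m ->
  \sum_(b < N.+1) cblock Q a b *m LST_bd m b =
  ((s * (A a)%:R) *: cost_mx c a) *m LST_bd m a.
Proof.
rewrite -ltnS => ha am; apply/matrixP => i j.
pose x := mkstate ha i.
have g0 y : 0 <= cost_rate y.
  by rewrite mulr_ge0// hc// -ltnS ltn_ord.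
have delta1 (y : state N K) : sqmod (phase_indic j y) <= 1.
  rewrite /sqmod /phase_indic; case: eqP => _ /=.
    by rewrite expr1n expr0n addr0.
  by rewrite expr0n addr0.
have hx : ~~ (level x == m) by [].
have := generator_equation (hit := fun y => level y == m) hZ hs g0 delta1 hx.
have BE y : (if level y == m then phase_indic j y else
    hitting_value P Z (fun x => level x == m) cost_rate (phase_indic j) s y) =
    LST_bd m (level y) (tagged y) j.
  rewrite mxE; case: ifP => // _.
  by case: y => -[b hb] k; rewrite (LSTE hb).
under eq_bigr do rewrite BE.
move=> ge; rewrite summxE.
transitivity (\sum_y (rate Q x y)%:C%C * LST_bd m (level y) (tagged y) j).
  under eq_bigr do rewrite mxE.
  rewrite (sig_big_dep (fun=> true) (fun _ _ => true)
    (fun (b : 'I_N.+1) k => (cblock Q a b) i k * (LST_bd m b) k j)) /=.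
  by apply: eq_bigr => y _; rewrite mxE.
rewrite ge -scalemxAl mxE mul_diag_mx mxE [LST_bd m a i j]mxE (negbTE am).
rewrite (LSTE ha) mxE.
rewrite /cost_rate /= rmorphM rmorph_nat /=; ring.
Qed.

Lemma cblock_skip (a b : nat) : (a <= N)%N -> (b <= N)%N ->
  (a.+1 < b)%N || (b.+1 < a)%N -> cblock Q a b = 0.
Proof.
rewrite -ltnS => ha; rewrite -ltnS => hb ab; apply/matrixP => i j; rewrite !mxE.
have := rate_skip hQ (x := mkstate ha i) (y := mkstate hb j) ab.
by rewrite /rate /= => ->.
Qed.

Let Qs a := cblock Q a a - (s * (A a)%:R) *: cost_mx c a.

Lemma block_equation0 m : (0 < m <= N)%N ->
  Qs 0 *m LST_bd m 0 = - (cblock Q 0 1 *m LST_bd m 1).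
Proof.
move=> /andP[m0 mN].
have h1 : (1 < N.+1)%N by rewrite ltnS (leq_trans m0).
have := block_equation (leq0n N) (negbT (ltn_eqF m0)).
rewrite (bigD1 ord0)//= (bigD1 (Ordinal h1))//= big1 ?addr0 => [eq|b].
  by apply/eqP; rewrite -addr_eq0 mulmxBl -eq addrAC subrr.
rewrite -!val_eqE /= => /andP[b0 b1].
rewrite cblock_skip ?mul0mx//; first by rewrite -ltnS.
by rewrite orbF ltn_neqAle eq_sym b1 lt0n b0.
Qed.

(** Tridiagonality leaves three levels of the row. The top one, a+2, may be the target itself. *)
Lemma block_equationS a m : (a.+1 < m <= N)%N ->
  Qs a.+1 *m LST_bd m a.+1 + cblock Q a.+1 a *m LST_bd m a =
  - (cblock Q a.+1 a.+2 *m LST_bd m a.+2).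
Proof.
move=> /andP[am mN].
have h2 : (a.+2 < N.+1)%N by rewrite ltnS (leq_trans am).
have h1 : (a.+1 < N.+1)%N by exact: ltnW.
have h0 : (a < N.+1)%N by exact: ltnW.
have := block_equation (ltnW h2 : (a.+1 <= N)%N) (negbT (ltn_eqF am)).
rewrite (bigD1 (Ordinal h0))//= (bigD1 (Ordinal h1))//=; last first.
  by rewrite -val_eqE /= gtn_eqF.
rewrite (bigD1 (Ordinal h2))//=; last by rewrite -!val_eqE /= !gtn_eqF.
rewrite big1 ?addr0 => [eq|b].
  apply/eqP; rewrite -addr_eq0 mulmxBl -eq; apply/eqP.
  move: (cblock Q a.+1 a *m _) (cblock Q a.+1 a.+1 *m _)
    (cblock Q a.+1 a.+2 *m _) => x y z.
  by apply/matrixP => i j; rewrite !mxE; ring.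
rewrite -!val_eqE /= -!andbA => /and3P[b0 b1 b2].
rewrite cblock_skip ?mul0mx//; first by rewrite -ltnS.
by move: b0 b1 b2; rewrite !neq_ltn; lia.
Qed.

Lemma solve_unitmx (p q r : nat) (U : 'M[R[i]]_p) (X : 'M[R[i]]_(p, q))
    (B : 'M[R[i]]_(p, r)) (Y : 'M[R[i]]_(r, q)) : U \in unitmx ->
  U *m X = - (B *m Y) -> X = - invmx U *m B *m Y.
Proof.
by move=> uU UX; rewrite mulNmx mulNmx -mulmxA -mulmxN -UX mulKmx.
Qed.

(** Block Gaussian elimination. The two claims are proved together: the pivot at level m+1 involves
    the transform from m to m+1, and eliminating level m needs the factorisation for every target t
    above m. *)
Lemma LST_elimination (M : nat) : (M <= N)%N -> Qs 0 \in unitmx ->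
  (forall m : nat, (m.+1 < M)%N ->
    Qs m.+1 + cblock Q m.+1 m *m LST P Z c A s m m.+1 \in unitmx) ->
  forall m, (m < M)%N ->
  LST P Z c A s m m.+1 =
    match m with
    | 0 => - invmx (Qs 0) *m cblock Q 0 1
    | m'.+1 => - invmx (Qs m'.+1 + cblock Q m'.+1 m' *m LST P Z c A s m' m'.+1)
                 *m cblock Q m'.+1 m'.+2
    end /\
  forall t, (m < t <= N)%N ->
    LST_bd t m = LST P Z c A s m m.+1 *m LST_bd t m.+1.
Proof.
move=> MN u0 uS; elim=> [|m IH] mM.
  have sol t : (0 < t <= N)%N ->
      LST_bd t 0 = - invmx (Qs 0) *m cblock Q 0 1 *m LST_bd t 1.
    by move=> tN; exact: solve_unitmx (block_equation0 tN).
  have e1 : LST P Z c A s 0 1 = - invmx (Qs 0) *m cblock Q 0 1.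
    by have := sol 1%N (leq_trans mM MN); rewrite LST_bd_id mulmx1 LST_bd_neq.
  by split=> // t tN; rewrite e1; exact: sol.
have [_ IHt] := IH (ltnW mM).
set U := Qs m.+1 + _.
have sol t : (m.+1 < t <= N)%N ->
    LST_bd t m.+1 = - invmx U *m cblock Q m.+1 m.+2 *m LST_bd t m.+2.
  move=> /andP[mt tN]; apply: solve_unitmx; first exact: uS.
  (* The block below the diagonal is eliminated by the induction hypothesis, which completes the
     pivot [U]. *)
  rewrite -block_equationS ?mt// mulmxDl; congr (_ + _).
  by rewrite -mulmxA -IHt// tN (ltnW mt).
have e1 : LST P Z c A s m.+1 m.+2 = - invmx U *m cblock Q m.+1 m.+2.
  (* For the target m+2 the remaining factor is the identity. *)
  have mN : (m.+1 < m.+2 <= N)%N by rewrite ltnSn (leq_trans mM).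
  by have := sol _ mN; rewrite LST_bd_id mulmx1 LST_bd_neq// neq_ltn ltnSn.
by split=> // t tN; rewrite e1; exact: sol.
Qed.

End Blocks.

Theorem lemma2 (R : realType) (N : nat) (K : nat -> nat)
  (Q : forall n m : nat, 'M[R]_((K n).+1, (K m).+1))
  (hQ : is_LDQBD_generator N Q)
  (d : measure_display) (T : measurableType d)
  (P : forall n : nat, 'I_(K n).+1 -> probability T R)
  (Z : R -> T -> state N K)
  (hZ : is_CTMC P Z Q)
  (c : forall n : nat, 'I_(K n).+1 -> R)
  (hc : forall (n : nat) (i : 'I_(K n).+1), (n <= N)%N -> 0 <= c n i)
  (n k : nat) (hn : (n < N)%N) (hk : (1 <= k <= N - n)%N)
  (A : pred nat) (hA : forall m : nat, A m -> (m <= N)%N)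
  (s : R[i]) (hs : 0 <= complex.Re s)
  (hinv0 : cblock Q 0 0 - (s * (A 0%N)%:R) *: cost_mx c 0 \in unitmx)
  (hinv : forall m : nat, (m.+1 < n + k)%N ->
    cblock Q m.+1 m.+1 - (s * (A m.+1)%:R) *: cost_mx c m.+1
      + cblock Q m.+1 m *m LST P Z c A s m m.+1 \in unitmx) :
  [/\ LST P Z c A s n (k + n)%N
        = level_prod (fun m : nat => LST P Z c A s m m.+1) n k,
      LST P Z c A s 0 1
        = - invmx (cblock Q 0 0 - (s * (A 0%N)%:R) *: cost_mx c 0)
            *m cblock Q 0 1 &
      forall m : nat, (m.+1 < n + k)%N ->
        LST P Z c A s m.+1 m.+2
          = - invmx (cblock Q m.+1 m.+1 - (s * (A m.+1)%:R) *: cost_mx c m.+1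
                     + cblock Q m.+1 m *m LST P Z c A s m m.+1)
              *m cblock Q m.+1 m.+2].
Proof.
have hnk : (n + k <= N)%N by move: hk => /andP[_]; rewrite -leq_subRL// ltnW.
have elim := LST_elimination hQ hZ hc hs hnk hinv0 hinv.
have n0 : (0 < n + k)%N by move: hk => /andP[k0 _]; rewrite addn_gt0 k0 orbT.
(* Levels are peeled off one at a time; at k' = k the remaining factor is the identity. *)
have prod k' : (k' <= k)%N -> LST_bd P Z c A s (k + n) n =
    level_prod (fun m => LST P Z c A s m m.+1) n k' *m
    LST_bd P Z c A s (k + n) (k' + n).
  elim: k' => [|k' IH] kk; first by rewrite mul1mx.
  rewrite IH ?(ltnW kk)//= -mulmxA; congr (_ *m _).
  have [|_ ->//] := elim (k' + n)%N; first by rewrite addnC ltn_add2l.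
  by rewrite ltn_add2r kk addnC hnk.
split.
- rewrite -LST_bd_neq; first by rewrite (prod k)// LST_bd_id mulmx1.
  move: hk => /andP[k0 _].
  by rewrite -[n in X in X != _]add0n eqn_add2r eq_sym -lt0n.
- by have [] := elim 0%N n0.
- by move=> m mnk; have [] := elim m.+1 mnk.
Qed.
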